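(* Let $p\ge 1$ be an integer, let $\boldsymbol{\beta}=(\beta_0,\ldots,\beta_{p-1})$ be an alternate base (i.e., $\beta_i>1$ real for all $i$), and set $\beta=\prod_{i=0}^{p-1}\beta_i$. \begin{enumerate} \item If $\mathbb Q\cap[0,1)\subseteq\bigcap_{i=0}^{p-1}\mathrm{Per}(\boldsymbol{\beta}^{(i)})$, then $\beta_0,\ldots,\beta_{p-1}\in\mathbb Q(\beta)$ and $\beta$ is either a Pisot number or a Salem number. \item If $\beta$ is a Pisot number and $\beta_0,\ldots,\beta_{p-1}\in\mathbb Q(\beta)$, then $\mathrm{Per}(\boldsymbol{\beta})=\mathbb Q(\beta)\cap[0,1)$. \end{enumerate}
   Context: An alternate base is a $p$-tuple $\boldsymbol{\beta}=(\beta_0,\ldots,\beta_{p-1})$ of real numbers $\beta_i>1$. Indices are taken modulo $p$: $\beta_n=\beta_{n\bmod p}$ for all $n\in\mathbb N$, and for $i\in\mathbb N$ the shifted base is $\boldsymbol{\beta}^{(i)}=(\beta_i,\beta_{i+1},\ldots,\beta_{i+p-1})$. For $x\in[0,1)$, the (greedy) $\boldsymbol{\beta}$-expansion $d_{\boldsymbol{\beta}}(x)=(\varepsilon_n)_{n\in\mathbb N}$ is defined by $r_0=x$ and, for $n\in\mathbb N$, $\varepsilon_n=\lfloor\beta_n r_n\rfloor$, $r_{n+1}=\beta_n r_n-\varepsilon_n$. $\mathrm{Per}(\boldsymbol{\beta})$ denotes the set of $x\in[0,1)$ whose $\boldsymbol{\beta}$-expansion $d_{\boldsymbol{\beta}}(x)$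 is ultimately periodic. A Pisot number is an algebraic integer $\beta>1$ all of whose Galois conjugates other than $\beta$ have modulus $<1$; a Salem number is an algebraic integer $\beta>1$ all of whose Galois conjugates other than $\beta$ have modulus $\le 1$, with equality for at least one of them. *)

(* Defs.v *)
From HB Require Import structures.
From mathcomp Require Import all_boot all_order all_algebra.
From mathcomp Require Import all_classical all_reals.
From mathcomp Require Import complex.

Set Implicit Arguments.
Unset Strict Implicit.
Unset Printing Implicit Defensive.

Import Order.TTheory GRing.Theory Num.Theory.

Local Open Scope classical_set_scope.
Local Open Scope ring_scope.
Local Open Scope complex_scope.

Definition ult_periodic (T : Type) (u : nat -> T) : Prop :=
  exists n0 m : nat, (0 < m)%N /\ forall n, (n0 <= n)%N -> u (n + m)%N = u n.

Section AlternateBase.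
Variables (R : realType) (p : nat).
Implicit Types (B : p.-tuple R) (x : R).

Definition alternate_base B : Prop := forall i : 'I_p, 1 < tnth B i.

(* B_n = B_(n mod p); the default value 0 is only reached when p = 0. *)
Definition base B (n : nat) : R := nth 0 B (n %% p)%N.

Definition shift_base B (i : nat) : p.-tuple R := [tuple base B (i + j)%N | j < p].

Fixpoint remainder B x (n : nat) : R :=
  if n is k.+1 then
    base B k * remainder B x k - (Num.floor (base B k * remainder B x k))%:~R
  else x.

Definition expansion B x (n : nat) : int :=
  Num.floor (base B n * remainder B x n).

Definition Per B : set R :=
  [set x | 0 <= x < 1 /\ ult_periodic (expansion B x)].

End AlternateBase.

Section Numbers.
Variable R : realType.
Implicit Types (b : R) (z : R[i]).

(* The subfield Q(b) of R; b may be transcendental, so quotients are needed. *)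
Definition Qfield b : set R :=
  [set x | exists f g : {poly rat}, (map_poly ratr g).[b] != 0 /\
             x = (map_poly ratr f).[b] / (map_poly ratr g).[b]].

Definition is_min_poly b (f : {poly rat}) : Prop :=
  [/\ f \is monic, irreducible_poly f & root (map_poly ratr f) b].

(* b itself counts among its conjugates. *)
Definition galois_conjugate b z : Prop :=
  exists2 f : {poly rat}, is_min_poly b f & root (map_poly ratr f) z.

Definition algebraic_integer b : Prop := integralOver (intr : int -> R) b.

(* `|z| : R[i] is the modulus of z, and the order of R[i] restricts to the
   usual order on real elements. *)
Definition Pisot b : Prop :=
  [/\ 1 < b, algebraic_integer b &
      forall z, galois_conjugate b z -> z <> b%:C -> `|z| < 1].

Definition Salem b : Prop :=
  [/\ 1 < b, algebraic_integer b,
      forall z, galois_conjugate b z -> z <> b%:C -> `|z| <= 1 &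
      exists z, [/\ galois_conjugate b z, z <> b%:C & `|z| = 1]].

End Numbers.

(* Main.v *)
Require Import Defs.
From HB Require Import structures.
From mathcomp Require Import all_boot all_order all_algebra.
From mathcomp Require Import all_classical all_reals.
From mathcomp Require Import separable complex ring lra zify.

(**
Write [pi_n = beta_0 ... beta_(n-1)], [y = 1 / beta] and [e_k = 1 / pi_(k+1)].
Grouping the digits of [x] by residues mod [p], ultimate periodicity of the
expansion of [x] amounts to a relation [(1 - y^m) x = sum_(k < p) e_k Q_k(y)]
with [Q_k] an integer polynomial, the difference of a long and a shifted short
partial sum of the digits at the places [k] mod [p].

Rationals periodic.  A rational slightly above [e_j] has the digits 0 ... 0 1
(at place [j]) followed by a long run of zeros, so that [Q_k(w)] is close to
[delta_jk] for every [|w| < 1].  At [w = y] this gives a diagonally dominant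
system for the [e_k], whence [e_k] is in [Q(y)] and so is each [beta_i].  Applied
to [x = 1 / b], the relation reads [D(y) (1 - y^m) = b P(y)] with [D] fixed: a
large [b] excludes that [y] is transcendental, and then, with [D] an integer
absorbed in [b], taking for [b] the constant coefficient of the primitive
minimal polynomial of [y] forces that coefficient to be a unit, i.e. [beta] is an
algebraic integer.  Finally, if [z] is a conjugate with [|z| > 1], the relation
for a rational near [e_(p-1) = y] also holds with [w = 1 / z] in place of [y];
it says that this rational is near [w], so [w = y].

Pisot base.  For [x] in [Q(beta)] a fixed multiple of the remainder of rank [pn]
is [G_n(beta)] with [G_n] in [Z[X]], and the values of [G_n] at all conjugates of
[beta] are bounded because these contract.  Modulo the minimal polynomial, the
Vandermonde matrix of the conjugates bounds the coefficients of [G_n], and two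
remainders must coincide.
*)

Set Implicit Arguments.
Unset Strict Implicit.
Unset Printing Implicit Defensive.

Import Order.TTheory GRing.Theory Num.Theory.

Local Open Scope classical_set_scope.
Local Open Scope ring_scope.

Local Notation evZ g u := (map_poly intr g).[u].
Local Notation evQ g u := (map_poly ratr g).[u].

(** * Polynomials over the rationals and their values *)

Lemma horner_ratr_intr (F : numFieldType) (g : {poly int}) (u : F) :
  evQ (map_poly (intr : int -> rat) g) u = evZ g u.
Proof.
rewrite -map_poly_comp; congr (_.[_]).
by apply: eq_map_poly => a /=; rewrite ratr_int.
Qed.

Lemma horner_intr_ratrZ (F : numFieldType) (g : {poly rat}) (a : int)
    (h : {poly int}) (u : F) :
  a != 0 -> g = a%:~R^-1 *: map_poly intr h -> evZ h u = a%:~R * evQ g u.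
Proof.
move=> a0 ->; rewrite map_polyZ hornerZ horner_ratr_intr fmorphV rmorph_int.
by rewrite mulrA divff ?mul1r // intr_eq0.
Qed.

(** The gcd of [g] with an irreducible [f] is [f] or 1; in the second case Bezout inverts [g] modulo
    [f]. *)
Lemma irreducible_dvd_or_inverse (F : numFieldType) (f g : {poly rat}) (u : F) :
  irreducible_poly f -> root (map_poly ratr f) u ->
  f %| g \/ exists h : {poly rat}, evQ h u * evQ g u = 1.
Proof.
move=> [_ irr] fu; have [cop|ncop] := boolP (coprimep f g); [right|left].
  have /Bezout_coprimepP[[a b] /= /eqpf_eq[c c0 E]] := cop.
  have : (map_poly (ratr : rat -> F) (a * f + b * g)).[u] = ratr c.
    by rewrite E map_polyZ /= rmorph1 hornerZ hornerC mulr1.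
  rewrite rmorphD !rmorphM /= hornerD !hornerM (rootP fu) mulr0 add0r => bg.
  exists (c^-1 *: b); rewrite map_polyZ hornerZ /= -mulrA bg -rmorphM.
  by rewrite mulVf ?rmorph1.
have /andP[_ fd] := irr _ ncop (dvdp_gcdl f g).
exact: dvdp_trans fd (dvdp_gcdr f g).
Qed.

Lemma irreducible_dvd (F : numFieldType) (f g : {poly rat}) (u : F) :
  irreducible_poly f -> root (map_poly ratr f) u -> evQ g u = 0 -> f %| g.
Proof.
move=> irr fu gu; have [//|[h]] := irreducible_dvd_or_inverse g irr fu.
by rewrite gu mulr0 => /esym/eqP; rewrite oner_eq0.
Qed.

Lemma irreducible_root_transfer (F L : numFieldType) (f g : {poly rat}) (u : F)
    (v : L) :
  irreducible_poly f -> root (map_poly ratr f) u -> root (map_poly ratr f) v ->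
  evQ g u = 0 -> evQ g v = 0.
Proof.
move=> irr fu fv /(irreducible_dvd irr fu)/dvdpP[q ->].
by rewrite rmorphM hornerM (rootP fv) mulr0.
Qed.

Lemma irreducible_inverse (F : numFieldType) (f g : {poly rat}) (u : F) :
  irreducible_poly f -> root (map_poly ratr f) u -> evQ g u != 0 ->
  exists h : {poly rat}, evQ h u * evQ g u = 1.
Proof.
move=> irr fu gu; have [/dvdpP[q qE]|//] := irreducible_dvd_or_inverse g irr fu.
by move: gu; rewrite qE rmorphM hornerM (rootP fu) mulr0 eqxx.
Qed.

(** A nonzero annihilating polynomial of least degree is irreducible: one of two proper factors
    would vanish at [u] and be shorter. *)
Lemma min_poly_exists (R : realType) (u : R) (g : {poly rat}) :
  g != 0 -> evQ g u = 0 -> exists f, is_min_poly u f.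
Proof.
move=> g0 gu.
pose P n := `[< exists f : {poly rat}, [/\ size f = n, f != 0 & evQ f u = 0] >].
have exP : exists n, P n by exists (size g); apply/asboolP; exists g.
case: (ex_minnP exP) => n /asboolP[f [sf f0 fu]] minf.
have {}minf (h : {poly rat}) : h != 0 -> evQ h u = 0 -> (size f <= size h)%N.
  by move=> h0 hu; rewrite sf; apply: minf; apply/asboolP; exists h.
have sf1 : (1 < size f)%N.
  rewrite ltnNge; apply/negP => /size1_polyC fE; move: f0 fu; rewrite fE.
  by rewrite map_polyC hornerC polyC_eq0 => h /eqP; rewrite fmorph_eq0 (negbTE h).
exists ((lead_coef f)^-1 *: f).
have lf : lead_coef f != 0 by rewrite lead_coef_eq0.
split.
- by rewrite monicE lead_coefZ mulVf.
- split; first by rewrite size_scale ?invr_eq0.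
  move=> q sq; rewrite dvdpZr ?invr_eq0 // => qf.
  rewrite (eqp_rtrans (eqp_scale _ _)) ?invr_eq0 //.
  have /dvdpP[c E] := qf.
  have c0 : c != 0 by apply: contraNneq f0 => c0; rewrite E c0 mul0r.
  have q0 : q != 0 by apply: contraNneq f0 => q0; rewrite E q0 mulr0.
  move: fu; rewrite E rmorphM hornerM => /eqP; rewrite mulf_eq0 => /orP[/eqP cu|/eqP qu].
    have := minf _ c0 cu; rewrite E size_mul //.
    by move: sq; have := size_poly_gt0 q; rewrite q0; move: (size q) (size c) => [|[|]] //; lia.
  by rewrite -E -dvdp_size_eqp // eqn_leq dvdp_leq //= minf.
- by rewrite rootE map_polyZ hornerZ fu mulr0.
Qed.

Lemma exprn_unbounded (R : realType) (b K : R) : 1 < b -> exists N, K < b ^+ N.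
Proof.
move=> b1; have d0 : 0 < b - 1 by rewrite subr_gt0.
have bern n : 1 + (b - 1) *+ n <= b ^+ n.
  elim: n => [|n IH]; first by rewrite mulr0n addr0 expr0.
  rewrite exprS; apply: le_trans (_ : b * (1 + (b - 1) *+ n) <= _); last first.
    by rewrite ler_pM2l // (lt_trans ltr01).
  rewrite mulrS -[_ *+ n]mulr_natl.
  have : 0 <= n%:R * (b - 1) ^+ 2 by rewrite mulr_ge0 ?sqr_ge0.
  lra.
exists (Num.trunc (K / (b - 1))).+1; apply: lt_le_trans (bern _).
have := truncnS_gt (K / (b - 1)).
by rewrite ltr_pdivrMr // mulr_natl => /lt_le_trans; apply; rewrite lerDr.
Qed.

(** The reciprocal polynomial, which passes between values at [beta] and at its inverse. *)
Definition reverse_poly (A : nzRingType) (g : {poly A}) : {poly A} :=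
  \poly_(i < size g) g`_(size g - i.+1).

Lemma horner_reverse_poly (A : nzRingType) (F : fieldType) (h : {rmorphism A -> F})
    (g : {poly A}) (u : F) : u != 0 ->
  (map_poly h (reverse_poly g)).[u] = u ^+ (size g).-1 * (map_poly h g).[u^-1].
Proof.
move=> u0; have sz q : (size (map_poly h q) <= size q)%N by apply: size_poly.
rewrite (horner_coef_wide _ (leq_trans (sz _) (size_poly _ _))).
rewrite (horner_coef_wide _ (sz g)) mulr_sumr (reindex_inj rev_ord_inj) /=.
apply: eq_bigr => i _; rewrite !coef_map coef_poly.
have i_lt : (i < size g)%N by [].
rewrite subnSK // leq_subr subKn 1?ltnW // mulrCA; congr (_ * _).
have le : (i <= (size g).-1)%N by rewrite -ltnS prednK // (leq_ltn_trans _ i_lt).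
by rewrite exprVn -expfB_cond ?(negbTE u0) ?add0n // -subn1 -subnDA add1n.
Qed.

(** The reversed polynomial has the constant coefficient of [g], a sign, as leading coefficient;
    multiplying by that sign makes it monic. *)
Lemma reverse_poly_integral (F : fieldType) (g : {poly int}) (u : F) :
  u != 0 -> (`|(g`_0)%R| = 1)%N -> evZ g u^-1 = 0 ->
  integralOver (intr : int -> F) u.
Proof.
move=> u0 g1 gu; have sg : g`_0 * g`_0 = 1 by move: g1; case: (g`_0) => -[|[|]] //.
have g0 : (0 < size g)%N.
  by rewrite lt0n size_poly_eq0; apply: contra_eqN g1 => /eqP->; rewrite coef0.
exists (g`_0 *: reverse_poly g).
  have gn : g`_(size g - (size g).-1.+1) = g`_0 by rewrite prednK ?subnn.
  rewrite monicE lead_coefZ lead_coef_poly // gn ?sg //.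
  by apply: contra_eqN g1 => /eqP->.
by rewrite rootE map_polyZ hornerZ horner_reverse_poly // gu !mulr0.
Qed.

Lemma Qfield_ratio_inv (R : realType) (u : R) (f g : {poly int}) : u != 0 ->
  evZ g u^-1 != 0 -> Qfield u (evZ f u^-1 / evZ g u^-1).
Proof.
move=> u0 gu.
(* The extra powers of [X] balance the powers of [u] that the two reversals produce. *)
exists (map_poly intr (reverse_poly f * 'X^((size g).-1))),
  (map_poly intr ('X^((size f).-1) * reverse_poly g)).
rewrite !horner_ratr_intr !rmorphM /= !map_polyXn !hornerM !hornerXn.
rewrite !horner_reverse_poly //.
by split; [rewrite !mulf_neq0 ?expf_neq0|field; rewrite gu !expf_neq0].
Qed.

(** With [t < 1] the larger ratio, the right-hand side is at most [(1 + k) * t ^+ M], which falls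
    below any positive [g]. *)
Lemma squeeze_geometric (R : realType) (y w k g : R) :
  0 < y < 1 -> 0 <= w < 1 -> 0 <= k ->
  (forall M, g <= y ^+ M.+1 + k * w ^+ M.+1) -> g <= 0.
Proof.
move=> /andP[y0 y1] /andP[w0 w1] k0 H; rewrite leNgt; apply/negP => g0.
pose t := Num.max y w.
have t0 : 0 < t by rewrite lt_max y0.
have t1 : t < 1 by rewrite gt_max y1 w1.
have ti1 : 1 < t^-1 by rewrite invf_gt1.
have [N HN] := exprn_unbounded ((1 + k) / g) ti1.
have := H N; apply/negP; rewrite -ltNge.
apply: le_lt_trans (_ : (1 + k) * t ^+ N < _); last first.
  by move: HN; rewrite exprVn ltr_pdivrMr // mulrC -ltr_pdivrMr ?invr_gt0 ?exprn_gt0 // invrK.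
have tS : t ^+ N.+1 <= t ^+ N by rewrite exprS ger_pMl ?exprn_gt0 // ltW.
have le z : 0 <= z -> z <= t -> z ^+ N.+1 <= t ^+ N.
  by move=> z0 zt; apply: le_trans tS; apply: lerXn2r => //; rewrite nnegrE ltW.
by rewrite mulrDl mul1r lerD ?ler_wpM2l ?le // ?le_max ?lexx ?orbT // ltW.
Qed.

(** In characteristic 0 the derivative of [f] is nonzero and of smaller degree, so an irreducible
    [f] is prime to it. *)
Lemma irreducible_uniq_roots (F : closedFieldType) (h : {rmorphism rat -> F})
    (f : {poly rat}) : f \is monic -> irreducible_poly f ->
  exists2 s : seq F, uniq s & map_poly h f = \prod_(z <- s) ('X - z%:P).
Proof.
move=> fm [sf irr]; have [s sE] := closed_field_poly_normal (map_poly h f).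
have fE : map_poly h f = \prod_(z <- s) ('X - z%:P).
  by rewrite sE lead_coef_map (monicP fm) rmorph1 scale1r.
exists s => //; rewrite -separable_prod_XsubC -fE separable_map separable_poly.unlock.
apply/negP => /negP ncop; have /eqp_size sg := irr _ ncop (dvdp_gcdl _ _).
have d0 : f^`() != 0.
  apply/eqP => f'0; have := coef_deriv f (size f).-2.
  have -> : (size f).-2.+1 = (size f).-1 by move: sf; case: (size f) => [|[]].
  rewrite f'0 coef0 -lead_coefE (monicP fm) => /esym/eqP; rewrite pnatr_eq0.
  by move: sf; case: (size f) => [|[]].
have := dvdp_leq d0 (dvdp_gcdr f f^`()); rewrite sg.
by rewrite leqNgt lt_size_deriv // -size_poly_gt0 ltnW.
Qed.

(** Gauss's lemma: a monic integer annihilator factors over the integers through a multiple of [f],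
    whose leading coefficient then divides 1. *)
Lemma monic_integral_min_poly (R : realType) (u : R) (f : {poly rat}) :
  algebraic_integer u -> is_min_poly u f ->
  exists2 g : {poly int}, g \is monic & map_poly intr g = f.
Proof.
move=> [h hm hu] [fm irr fu].
have fh : f %| map_poly intr h.
  by apply: irreducible_dvd irr fu _; rewrite horner_ratr_intr; apply/rootP.
have [g [a a0 fE] [q hE]] := dvdpP_rat_int fh.
have lg : lead_coef g * lead_coef q = 1 by rewrite -lead_coefM -hE (monicP hm).
have lgU : lead_coef g * lead_coef g = 1.
  have : lead_coef g \is a GRing.unit by apply/unitrPr; exists (lead_coef q).
  by rewrite unfold_in /= => /pred2P[] ->.
exists (lead_coef g *: g); first by rewrite monicE lead_coefZ lgU.
have lg0 : lead_coef g != 0 by apply: contraTneq isT => lg0; rewrite lg0 mul0r in lgU.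
have : a * (lead_coef g)%:~R = 1.
  by move/monicP: fm; rewrite fE lead_coefZ lead_coef_map_id0 ?intr_eq0.
move=> alg; rewrite map_polyZ fE; congr (_ *: _).
by rewrite -[LHS]mul1r -alg -mulrA -intrM lgU mulr1.
Qed.

Lemma common_denominator (I : finType) (E : I -> {poly rat}) :
  exists (D : int) (N : I -> {poly int}), D != 0 /\
    forall i (F : numFieldType) (u : F), evZ (N i) u = D%:~R * evQ (E i) u.
Proof.
pose q i := projT1 (rat_poly_scale (E i)).
pose a i := s2val (projT2 (rat_poly_scale (E i))).
have a0 i : a i != 0 := s2valP (projT2 (rat_poly_scale (E i))).
have aE i : E i = (a i)%:~R^-1 *: map_poly intr (q i) :=
  s2valP' (projT2 (rat_poly_scale (E i))).
exists (\prod_i a i), (fun i => (\prod_(j | j != i) a j)%:P * q i); split.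
  by apply/prodf_neq0.
move=> i F u; rewrite rmorphM /= hornerM map_polyC hornerC (horner_intr_ratrZ u (a0 i) (aE i)).
by rewrite [in RHS](bigD1 i) //= intrM mulrA [_%:~R * (a i)%:~R]mulrC.
Qed.

(** The inverse Vandermonde matrix recovers the coefficients from the values at distinct points. *)
Lemma Vandermonde_coef_bound (R : realType) (d : nat) (z : 'I_d -> R[i])
    (K : 'I_d -> R) :
  injective z ->
  exists b : nat, forall c : 'I_d -> int,
    (forall j, `|\sum_i (c i)%:~R * z j ^+ i| <= (K j)%:C%C) ->
    forall i, (`|c i| <= b)%N.
Proof.
move=> zI; pose V := Vandermonde d (\row_j z j).
have VU : V \in unitmx.
  rewrite unitmxE unitfE det_Vandermonde; apply/prodf_neq0 => i _.
  apply/prodf_neq0 => j ij; rewrite !mxE subr_eq0; apply/eqP => /zI ji.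
  by rewrite ji ltnn in ij.
(* Summing over [i] as well gives a single bound for all coefficients. *)
pose S : R[i] := \sum_i \sum_j (K j)%:C%C * `|invmx V j i|.
exists (Num.trunc (complex.Re S)) => c cK i.
have c_eq : (c i)%:~R = \sum_j (\sum_i0 (c i0)%:~R * z j ^+ i0) * invmx V j i :> R[i].
  pose cr : 'rV[R[i]]_d := \row_i (c i)%:~R.
  have : cr *m V *m invmx V = cr by rewrite mulmxK.
  move/(congr1 (fun v : 'rV_d => v 0 i)); rewrite !mxE => <-.
  apply: eq_bigr => j _; rewrite !mxE; congr (_ * _); apply: eq_bigr => k _.
  by rewrite !mxE.
have K0 j : 0 <= (K j)%:C%C by apply: le_trans (cK j).
have cS : `|(c i)%:~R| <= S.
  rewrite c_eq; apply: le_trans (ler_norm_sum _ _ _) _.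
  rewrite /S [leRHS](bigD1 i) //= ler_wpDr ?sumr_ge0 // => [k _|].
    by rewrite sumr_ge0 // => j _; rewrite mulr_ge0.
  by apply: ler_sum => j _; rewrite normrM ler_wpM2r.
rewrite truncn_ge_nat; last first.
  by move: (le_trans (normr_ge0 _) cS); rewrite lecE => /andP[].
move: cS; rewrite -intr_norm -abszE -pmulrn -(rmorph_nat (real_complex R)).
by rewrite lecE => /andP[].
Qed.

Lemma pigeonhole_nat (T : finType) (u : nat -> T) :
  exists i j, (i < j)%N /\ u i = u j.
Proof.
apply: contrapT => H.
have uI : injective (fun i : 'I_(#|T|.+1) => u i).
  move=> i j uij; apply/val_inj; apply: contrapT => /eqP ij; apply: H.
  by case: (ltngtP i j) ij => // ? _; [exists i, j|exists j, i].
by have := leq_card _ uI; rewrite card_ord ltnn.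
Qed.

Lemma Qfield_mul (R : realType) (u x1 x2 : R) :
  Qfield u x1 -> Qfield u x2 -> Qfield u (x1 * x2).
Proof.
move=> [f1 [g1 [g10 ->]]] [f2 [g2 [g20 ->]]]; exists (f1 * f2), (g1 * g2).
by rewrite !rmorphM /= !hornerM mulf_div; split; rewrite ?mulf_neq0.
Qed.

Lemma Qfield_inv (R : realType) (u x : R) : Qfield u x -> Qfield u x^-1.
Proof.
move=> [f [g [g0 ->]]]; have [f0|f0] := eqVneq (evQ f u) 0.
  by exists 0, 1; rewrite rmorph1 rmorph0 horner0 hornerC oner_neq0 f0 !mul0r invr0.
by exists g, f; rewrite invf_div.
Qed.

(** Over an algebraic [u] the denominator has a polynomial inverse. *)
Lemma Qfield_poly (R : realType) (u x : R) (f : {poly rat}) :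
  is_min_poly u f -> Qfield u x -> exists g : {poly rat}, x = evQ g u.
Proof.
move=> [_ irr fu] [g [d [d0 ->]]]; have [h hd] := irreducible_inverse irr fu d0.
exists (g * h); rewrite rmorphM hornerM /=; congr (_ * _).
by apply: (mulIf d0); rewrite hd mulVf.
Qed.

(** * Expansions and remainders *)

Definition base_prod (R : realType) (p : nat) (B : p.-tuple R) (n : nat) : R :=
  \prod_(i < n) base B i.

Section Dynamics.
Variables (R : realType) (p : nat) (B : p.-tuple R).
Hypotheses (p_gt0 : (0 < p)%N) (hB : alternate_base B).

Local Notation b := (base B).
Local Notation Pi := (base_prod B).
Local Notation r := (remainder B).
Local Notation eps := (expansion B).
Local Notation beta := (Pi p).

Lemma base_mod_small (i : 'I_p) : b i = tnth B i.
Proof. by rewrite /base modn_small // (tnth_nth 0). Qed.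

Lemma base_gt1 n : 1 < b n.
Proof.
have := hB (Ordinal (ltn_pmod n p_gt0)).
by rewrite -base_mod_small /base /= modn_mod.
Qed.

Lemma base_gt0 n : 0 < b n.
Proof. exact: lt_trans ltr01 (base_gt1 n). Qed.

Lemma base_prodS n : Pi n.+1 = Pi n * b n.
Proof. by rewrite /base_prod big_ord_recr. Qed.

Lemma base_prod0 : Pi 0 = 1.
Proof. by rewrite /base_prod big_ord0. Qed.

Lemma base_prod_gt0 n : 0 < Pi n.
Proof. by apply: prodr_gt0 => i _; apply: base_gt0. Qed.

Lemma base_prod_neq0 n : Pi n != 0.
Proof. exact: lt0r_neq0 (base_prod_gt0 n). Qed.

Lemma base_prod_le m n : (m <= n)%N -> Pi m <= Pi n.
Proof.
move=> /subnKC <-; elim: (n - m)%N => [|k IH]; first by rewrite addn0.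
rewrite addnS base_prodS (le_trans IH) // ler_peMr ?ltW ?base_prod_gt0 //.
exact: base_gt1.
Qed.

Lemma base_prod_lt m n : (m < n)%N -> Pi m < Pi n.
Proof.
move=> mn; apply: lt_le_trans (base_prod_le mn).
by rewrite base_prodS ltr_pMr ?base_gt1 ?base_prod_gt0.
Qed.

Lemma base_prodD N k : Pi (p * N + k) = beta ^+ N * Pi k.
Proof.
elim: k => [|k IH]; last first.
  by rewrite addnS !base_prodS IH mulrA /base mulnC modnMDl.
rewrite addn0 base_prod0 mulr1; elim: N => [|N IH]; first by rewrite muln0 base_prod0.
rewrite mulnS addnC /base_prod big_split_ord /= -/(Pi (p * N)) IH exprSr.
by congr (_ * _); apply: eq_bigr => i _; rewrite /base mulnC modnMDl.
Qed.

Lemma beta_gt1 : 1 < beta.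
Proof. by rewrite -base_prod0; apply: base_prod_lt. Qed.

Lemma base_le_beta n : b n <= beta.
Proof.
rewrite /base_prod (bigD1 (Ordinal (ltn_pmod n p_gt0))) //= {2}/base modn_mod.
rewrite ler_peMr ?(ltW (base_gt0 _)) //.
by apply: (big_ind (fun z => 1 <= z)) => // [u v|i _]; [exact: mulr_ege1|exact/ltW/base_gt1].
Qed.

Lemma remainderS x n : r x n.+1 = b n * r x n - (eps x n)%:~R.
Proof. by []. Qed.

Lemma remainder_itv x n : 0 <= x < 1 -> 0 <= r x n < 1.
Proof.
move=> x01; case: n => [//|n]; rewrite remainderS /expansion.
have /andP[l h] := floor_itv (b n * r x n).
by rewrite subr_ge0 l /= ltrBlDl -intrD1.
Qed.

Lemma expansion_bounds x n : 0 <= x < 1 -> (0 : R) <= (eps x n)%:~R <= beta.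
Proof.
move=> x01; have /andP[r0 r1] := remainder_itv n x01.
rewrite ler0z floor_ge0 mulr_ge0 ?(ltW (base_gt0 n)) //=.
apply: le_trans (floor_le _) _; apply: le_trans (base_le_beta n).
by rewrite ler_piMr ?ltW ?base_gt0.
Qed.

Lemma remainder_sum x n :
  r x n / Pi n = x - \sum_(i < n) (eps x i)%:~R / Pi i.+1.
Proof.
elim: n => [|n IH]; first by rewrite base_prod0 big_ord0 divr1 subr0.
rewrite remainderS big_ord_recr /= opprD addrA -IH base_prodS.
have := lt0r_neq0 (base_gt0 n); have := base_prod_neq0 n => ? ?.
by field; apply/andP.
Qed.

(** As [Pi (p * n + k.+1)] is [beta ^+ n * Pi k.+1], the digits at places [k] modulo [p] contribute
    to [x] a polynomial in [beta^-1] divided by [Pi k.+1]. *)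
Definition digit_poly x (k N : nat) : {poly int} :=
  \poly_(n < N) eps x (p * n + k).

Lemma digit_polyS (F : numFieldType) x k N (u : F) :
  evZ (digit_poly x k N.+1) u =
  evZ (digit_poly x k N) u + (eps x (p * N + k))%:~R * u ^+ N.
Proof.
rewrite /digit_poly !poly_def big_ord_recr rmorphD /= hornerD map_polyZ hornerZ.
by rewrite map_polyXn hornerXn.
Qed.

Lemma digit_poly_sum x N :
  x - beta^-1 ^+ N * r x (p * N) =
  \sum_(k < p) (Pi k.+1)^-1 * evZ (digit_poly x k N) beta^-1.
Proof.
have -> : beta^-1 ^+ N * r x (p * N) = x - \sum_(i < p * N) (eps x i)%:~R / Pi i.+1.
  rewrite -remainder_sum; have := base_prodD N 0; rewrite addn0 base_prod0 mulr1 => ->.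
  by rewrite exprVn mulrC.
rewrite opprB addrC subrK.
elim: N => [|N IH].
  rewrite muln0 big_ord0 big1 // => k _.
  by rewrite /digit_poly poly_def big_ord0 rmorph0 horner0 mulr0.
rewrite mulnS addnC big_split_ord /= IH -big_split; apply: eq_bigr => k _ /=.
rewrite digit_polyS mulrDr; congr (_ + _).
by rewrite -addnS base_prodD invfM exprVn; ring.
Qed.

(* The difference of the two remainders is multiplied by [Pi i] after [i] steps,
   yet stays below 1. *)
Lemma remainder_eq x a c : 0 <= x < 1 ->
  (forall i, eps x (p * a + p * c + i) = eps x (p * a + i)) ->
  r x (p * a + p * c) = r x (p * a).
Proof.
move=> x01 E; apply/eqP; rewrite -subr_eq0; apply/eqP.
set d := _ - _.
have diff i : r x (p * a + p * c + i) - r x (p * a + i) = Pi i * d.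
  elim: i => [|i IH]; first by rewrite !addn0 base_prod0 mul1r.
  rewrite !addnS !remainderS E base_prodS.
  have -> : b (p * a + p * c + i) = b i by rewrite -mulnDr /base mulnC modnMDl.
  have -> : b (p * a + i) = b i by rewrite /base mulnC modnMDl.
  by rewrite mulrAC -IH; ring.
apply/eqP; apply: contraT; rewrite -normr_gt0 => d0.
have [N] := exprn_unbounded (`|d|^-1) beta_gt1.
have := base_prodD N 0; rewrite addn0 base_prod0 mulr1 => <-.
rewrite ltNge => /negP []; rewrite -[leRHS]mul1r ler_pdivlMr //.
have := diff (p * N)%N => D.
have -> : Pi (p * N) * `|d| = `|Pi (p * N) * d|.
  by rewrite normrM (ger0_norm (ltW (base_prod_gt0 _))).
rewrite -D.
have := remainder_itv (p * a + p * c + p * N) x01; have := remainder_itv (p * a + p * N) x01.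
move=> /andP[? ?] /andP[? ?]; rewrite ler_norml; apply/andP; split; lra.
Qed.

(** Multiples of a period are periods, so [m] can exceed any [M]; a large [m] later makes [w ^+ m]
    small for [|w| < 1]. *)
Lemma periodic_remainder x M : 0 <= x < 1 -> ult_periodic (eps x) ->
  exists n m, (M < m)%N /\ r x (p * (n + m)) = r x (p * n).
Proof.
move=> x01 [n0 [m [m0 per]]].
have per' t n : (n0 <= n)%N -> eps x (n + t * m) = eps x n.
  move=> h; elim: t => [|t IH]; first by rewrite addn0.
  by rewrite mulSn addnCA addnC per ?IH // (leq_trans h) ?leq_addr.
exists n0, (m * M.+1)%N; split; first by rewrite leq_pmull.
rewrite mulnDr; apply: remainder_eq => // i.
have -> : (p * n0 + p * (m * M.+1) + i = p * n0 + i + (p * M.+1) * m)%N by lia.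
by apply: per'; nia.
Qed.

(** The remainder and the place modulo [p] determine all later digits. *)
Lemma remainder_periodic x n m : (0 < m)%N -> r x (p * (n + m)) = r x (p * n) ->
  ult_periodic (eps x).
Proof.
move=> m0 E; exists (p * n)%N, (p * m)%N; split; first by rewrite muln_gt0 p_gt0.
have bE i : b (i + p * m) = b i by rewrite /base addnC mulnC modnMDl.
move=> i ni.
suff rE : r x (i + p * m) = r x i by rewrite /expansion rE bE.
rewrite -(subnKC ni); elim: (i - p * n)%N => [|j IH].
  by rewrite addn0 -mulnDr.
by rewrite addnS addSn !remainderS /expansion IH bE.
Qed.

(** * Period relations and rationals with a prescribed initial expansion *)

Definition period_poly x k n m : {poly int} :=
  digit_poly x k (n + m) - 'X^m * digit_poly x k n.

(** Subtracting [beta^-1 ^+ m] times the truncation at [n] blocks from that at [n + m] blocks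
    cancels the common remainder. *)
Lemma period_poly_sum x n m : r x (p * (n + m)) = r x (p * n) ->
  (1 - beta^-1 ^+ m) * x =
  \sum_(k < p) (Pi k.+1)^-1 * evZ (period_poly x k n m) beta^-1.
Proof.
move=> E.
have D1 := digit_poly_sum x (n + m); have D2 := digit_poly_sum x n.
transitivity (x - beta^-1 ^+ (n + m) * r x (p * (n + m)) -
   beta^-1 ^+ m * (x - beta^-1 ^+ n * r x (p * n))).
  by rewrite E exprD; ring.
rewrite D1 D2 mulr_sumr -sumrB; apply: eq_bigr => k _.
rewrite /period_poly rmorphB rmorphM /= map_polyXn hornerD hornerN hornerM hornerXn.
by ring.
Qed.

(** A natural number, so that the same digit bound makes sense in every numeric field. *)
Definition digit_max : nat := (Num.trunc beta).+1.

Lemma norm_expansion (F : numFieldType) x n : 0 <= x < 1 ->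
  `|(eps x n)%:~R : F| <= digit_max%:R.
Proof.
move=> x01; have /andP[e0 eb] := expansion_bounds n x01.
have le : (eps x n <= digit_max%:Z)%R.
  by rewrite -(ler_int R) (le_trans eb) // ltW // truncnS_gt.
rewrite ger0_norm; last by move: e0; rewrite !ler0z.
by rewrite -(ler_int F) in le.
Qed.

(** A geometric tail bound; with the factor [1 - |w|] the increments telescope. *)
Lemma digit_poly_tail (F : numFieldType) (w : F) x k N t :
  `|w| < 1 -> 0 <= x < 1 ->
  `|evZ (digit_poly x k (N + t)) w - evZ (digit_poly x k N) w| * (1 - `|w|) <=
  digit_max%:R * (`|w| ^+ N - `|w| ^+ (N + t)).
Proof.
move=> w1 x01; elim: t => [|t IH].
  by rewrite addn0 !subrr normr0 mul0r mulr0.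
rewrite addnS digit_polyS addrAC.
have w0 : 0 <= 1 - `|w| by rewrite subr_ge0 ltW.
apply: le_trans (ler_wpM2r w0 (ler_normD _ _)) _.
have e : `|(eps x (p * (N + t) + k))%:~R * w ^+ (N + t)| * (1 - `|w|) <=
    digit_max%:R * `|w| ^+ (N + t) * (1 - `|w|).
  by rewrite normrM normrX !ler_wpM2r ?exprn_ge0 // norm_expansion.
rewrite mulrDl; apply: le_trans (lerD IH e) _.
by rewrite exprS le_eqVlt; apply/orP; left; apply/eqP; ring.
Qed.

(** Greedy digits vanish while [Pi i.+1 * x < 1]; place [j] takes a 1, and the excess [d] over
    [(Pi j.+1)^-1] is too small to produce another digit before place [L]. *)
Lemma expansion_near_inv_base_prod x j L : (j < L)%N ->
  (Pi j.+1)^-1 <= x -> x < (Pi j)^-1 -> x < (Pi j.+1)^-1 + (Pi L)^-1 ->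
  forall i, (i < L)%N -> eps x i = (i == j)%:Z.
Proof.
move=> jL xl xj xL.
have x0 : 0 <= x by rewrite (le_trans _ xl) // invr_ge0 ltW ?base_prod_gt0.
have floor0 (z : R) : 0 <= z < 1 -> Num.floor z = 0.
  by move=> z01; apply: floor_def; rewrite add0r.
have r_lo i : (i <= j)%N -> r x i = Pi i * x /\ ((i < j)%N -> eps x i = 0).
  elim: i => [|i IH] ij.
  - split=> [|j0]; first by rewrite base_prod0 mul1r.
    rewrite /expansion /= floor0 // mulr_ge0 ?(ltW (base_gt0 _)) //=.
    rewrite (lt_le_trans (_ : _ < b 0 / Pi j)) ?ltr_pM2l ?base_gt0 //.
    rewrite ler_pdivrMr ?base_prod_gt0 // mul1r.
    by rewrite -[b 0]mul1r -base_prod0 -base_prodS base_prod_le.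
  - have [Ei /(_ ij) ei] := IH (ltnW ij).
    have ES : r x i.+1 = Pi i.+1 * x.
      by rewrite remainderS ei subr0 Ei base_prodS mulrCA mulrA.
    split=> // ij'; rewrite /expansion ES floor0 // mulrA [b _ * _]mulrC -base_prodS.
    rewrite mulr_ge0 ?(ltW (base_prod_gt0 _)) //=.
    rewrite (lt_le_trans (_ : _ < Pi i.+2 / Pi j)) ?ltr_pM2l ?base_prod_gt0 //.
    by rewrite ler_pdivrMr ?base_prod_gt0 // mul1r base_prod_le.
have [rj _] := r_lo j (leqnn j).
have low m n (z : R) : (m <= n)%N -> 0 <= z -> z < (Pi n)^-1 -> 0 <= Pi m * z < 1.
  move=> mn z0 zn; rewrite mulr_ge0 ?(ltW (base_prod_gt0 _)) //=.
  rewrite (lt_le_trans (_ : _ < Pi m / Pi n)) ?ltr_pM2l ?base_prod_gt0 //.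
  by rewrite ler_pdivrMr ?base_prod_gt0 // mul1r base_prod_le.
pose d := x - (Pi j.+1)^-1.
have d0 : 0 <= d by rewrite subr_ge0.
have dL : d < (Pi L)^-1 by rewrite ltrBlDl.
have xE : Pi j.+1 * x = 1 + Pi j.+1 * d.
  by rewrite /d mulrBr divff ?base_prod_neq0 // addrCA subrr addr0.
have ej : eps x j = 1.
  rewrite /expansion rj mulrA [b _ * _]mulrC -base_prodS; apply: floor_def.
  have /andP[l u] := low j.+1 L d jL d0 dL.
  by rewrite xE lerDl l /= intrD1 addrC ltrD2r.
have r_hi i : (j < i)%N -> (i <= L)%N -> r x i = Pi i * d.
  move=> /subnKC <-; elim: (i - j.+1)%N => [|k IH].
    rewrite addn0 => _; rewrite remainderS ej rj mulrA [b _ * _]mulrC -base_prodS.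
    by rewrite xE addrAC subrr add0r.
  rewrite addnS => kL; rewrite remainderS /expansion (IH (ltnW kL)).
  rewrite mulrA [b _ * _]mulrC -base_prodS floor0 ?subr0 //.
  exact: low d0 dL.
move=> i iL; case: (ltngtP i j) => [ij|ij|->] //.
- by have [_ ->] := r_lo i (ltnW ij).
- rewrite /expansion (r_hi _ ij (ltnW iL)) mulrA [b _ * _]mulrC -base_prodS floor0 //.
  exact: low d0 dL.
Qed.

(** A rational just above [(Pi j.+1)^-1] has a single nonzero digit in its first [M.+1] blocks, so
    the truncated digit polynomials are Kronecker deltas and only tails remain to be bounded. *)
Lemma rational_approximant j M :
  (forall q : rat, 0 <= (ratr q : R) < 1 -> ult_periodic (eps (ratr q))) ->
  (j < p)%N ->
  exists (q : rat) (m : nat) (Q : 'I_p -> {poly int}),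
    [/\ (M < m)%N, `|ratr q - (Pi j.+1)^-1| <= beta^-1 ^+ M.+1,
      0 <= (ratr q : R) < 1,
      (1 - beta^-1 ^+ m) * ratr q = \sum_(k < p) (Pi k.+1)^-1 * evZ (Q k) beta^-1 &
      forall (F : numFieldType) (w : F) (k : 'I_p), `|w| < 1 ->
        `|evZ (Q k) w - (k == j :> nat)%:R| * (1 - `|w|) <=
        (2 * digit_max)%:R * `|w| ^+ M.+1].
Proof.
move=> per jp; pose L := (p * M.+1)%N.
have jL : (j < L)%N by rewrite (leq_trans jp) // leq_pmulr.
have PL : (Pi L)^-1 = beta^-1 ^+ M.+1.
  by have := base_prodD M.+1 0; rewrite addn0 base_prod0 mulr1 => ->; rewrite exprVn.
have P0 n : 0 < (Pi n)^-1 by rewrite invr_gt0 base_prod_gt0.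
have : (Pi j.+1)^-1 < Num.min (Pi j)^-1 ((Pi j.+1)^-1 + (Pi L)^-1).
  by rewrite lt_min ltrDl P0 ltf_pV2 ?posrE ?base_prod_gt0 // base_prod_lt.
case/rat_in_itvoo => q; rewrite in_itv /= lt_min => /and3P[ql qj qL].
have q01 : 0 <= (ratr q : R) < 1.
  rewrite (le_trans (ltW (P0 _)) (ltW ql)) (lt_le_trans qj) //.
  by rewrite invf_le1 ?base_prod_gt0 // -base_prod0 base_prod_le.
have [n [m [Mm rE]]] := periodic_remainder M q01 (per q q01).
exists q, m, (fun k => period_poly (ratr q) k n m); split=> //.
- by rewrite -PL ger0_norm ?subr_ge0 ?(ltW ql) // lerBlDl ltW.
- exact: period_poly_sum.
move=> F w k w1.
have dig := expansion_near_inv_base_prod jL (ltW ql) qj qL.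
have dM : evZ (digit_poly (ratr q) k M.+1) w = (k == j :> nat)%:R.
  have : forall t, (t <= M)%N -> evZ (digit_poly (ratr q) k t.+1) w = (k == j :> nat)%:R.
    elim=> [|t IH] tM; rewrite digit_polyS dig.
    - rewrite /digit_poly poly_def big_ord0 rmorph0 horner0 add0r expr0 mulr1 muln0.
      by rewrite add0n; case: eqP.
    - by rewrite muln0 add0n (leq_trans (ltn_ord k)) // leq_pmulr.
    - have -> : (p * t.+1 + k == j)%N = false.
        by apply/negbTE; rewrite neq_ltn orbC (leq_trans jp) // mulnS -addnA leq_addr.
      by rewrite (IH (ltnW tM)) mul0r addr0.
    - by have := ltn_ord k; rewrite /L; nia.
  exact.
have w0 : 0 <= 1 - `|w| by rewrite subr_ge0 ltW.
rewrite /period_poly rmorphB rmorphM /= map_polyXn hornerD hornerN hornerM hornerXn.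
rewrite addrAC; apply: le_trans (ler_wpM2r w0 (ler_normB _ _)) _.
(* One [digit_max] pays for the tail of the long sum, the other for the short sum, which carries the
   factor [w ^+ m] with [M < m]. *)
rewrite mulrDl natrM mulr2n !mulrDl mul1r; apply: lerD.
  have nm : (M.+1 <= n + m)%N by rewrite (leq_trans Mm) ?leq_addl.
  have := digit_poly_tail k M.+1 (n + m - M.+1) w1 q01; rewrite subnKC // dM.
  move/le_trans; apply; apply: ler_wpM2l => //.
  by rewrite lerBlDr lerDl exprn_ge0.
have := digit_poly_tail k 0 n w1 q01; rewrite add0n.
rewrite {2}/digit_poly poly_def big_ord0 rmorph0 horner0 subr0 expr0 => h.
rewrite normrM normrX -mulrA mulrC.
apply: ler_pM; rewrite ?mulr_ge0 ?exprn_ge0 //; last first.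
  by apply: ler_wiXn2l => //; exact: ltW.
by apply: le_trans h _; rewrite ler_piMr // lerBlDr lerDl exprn_ge0.
Qed.

End Dynamics.

(** * Bases in which every rational is periodic *)

Section RationalsPeriodic.
Variables (R : realType) (p : nat) (B : p.-tuple R).
Hypotheses (p_gt0 : (0 < p)%N) (hB : alternate_base B).
Hypothesis per : forall q : rat, 0 <= (ratr q : R) < 1 ->
  ult_periodic (expansion B (ratr q)).

Local Notation beta := (base_prod B p).
Local Notation y := beta^-1.
Local Notation e k := (base_prod B k.+1)^-1.

Let y01 : 0 < y < 1.
Proof.
have b1 := beta_gt1 p_gt0 hB; have b0 := lt_trans ltr01 b1.
by rewrite invr_gt0 b0 invf_lt1.
Qed.

(** Cramer's rule for the relations of [p] rationals, the [j]-th one near [e j]; [D] is the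
    determinant. *)
Lemma inv_base_prod_ratio : exists (D : {poly int}) (N : 'I_p -> {poly int}),
  evZ D y != 0 /\ forall k : 'I_p, evZ D y * e k = evZ (N k) y.
Proof.
have /andP[y0 y1] := y01.
(* Chosen so that each entry is within [1 / p.+1] of the identity matrix: the [p] errors of a row
   then add up to less than 1. *)
pose K : R := (2 * digit_max B)%:R * p.+1%:R / (1 - y).
have [M KM] := exprn_unbounded K (beta_gt1 p_gt0 hB).
have small : (2 * digit_max B)%:R * y ^+ M.+1 * p.+1%:R <= 1 - y.
  have yM : 0 < y ^+ M by rewrite exprn_gt0.
  move: KM; rewrite /K ltr_pdivrMr ?subr_gt0 // => KM.
  rewrite mulrAC; apply: le_trans (_ : (beta ^+ M * (1 - y)) * y ^+ M.+1 <= _).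
    by apply: ler_wpM2r; rewrite ltW ?exprn_gt0.
  rewrite mulrAC exprS mulrCA -exprMn divff ?base_prod_neq0 // expr1n mulr1.
  by rewrite ler_piMl ?subr_ge0 ?ltW.
have H (j : 'I_p) : exists t : rat * nat * ('I_p -> {poly int}),
    (1 - y ^+ t.1.2) * ratr t.1.1 = \sum_(k < p) e k * evZ (t.2 k) y /\
    forall k : 'I_p, `|evZ (t.2 k) y - (k == j :> nat)%:R| * p.+1%:R <= 1.
  have [q [m [Q [_ _ _ E b]]]] := rational_approximant p_gt0 hB M per (ltn_ord j).
  exists (q, m, Q); split=> //= k.
  have ny : `|y| = y by rewrite ger0_norm ?ltW.
  have := b R y k; rewrite ny => /(_ y1) bk.
  rewrite -(ler_pM2r (_ : 0 < 1 - y)) ?subr_gt0 // mul1r mulrAC.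
  by apply: le_trans (ler_wpM2r (ler0n R p.+1) bk) small.
have [f fP] := choice H.
pose A : 'M[{poly int}]_p := \matrix_(j, k) ((denq (f j).1.1)%:P * (f j).2 k).
pose rhs : 'cV[{poly int}]_p := \col_j ((1 - 'X^((f j).1.2)) * (numq (f j).1.1)%:P).
pose phi : {rmorphism {poly int} -> R} :=
  GRing.RMorphism.clone _ _ (horner_eval y \o map_poly intr) _.
have phiE g : phi g = evZ g y by [].
have phiC a : phi a%:P = a%:~R by rewrite phiE map_polyC hornerC.
pose ev : 'cV[R]_p := \col_k e k.
have rel : map_mx phi A *m ev = map_mx phi rhs.
  apply/matrixP => j i; rewrite !mxE.
  have [E _] := fP j.
  have d0 : (denq (f j).1.1)%:~R != 0 :> R by rewrite intr_eq0 denq_neq0.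
  have qE : (numq (f j).1.1)%:~R = (denq (f j).1.1)%:~R * ratr (f j).1.1 :> R.
    by rewrite /ratr mulrCA divff ?mulr1.
  rewrite rmorphM rmorphB rmorph1 phiC phiE map_polyXn hornerXn qE mulrCA E mulr_sumr.
  by apply: eq_bigr => k _; rewrite !mxE rmorphM phiC mulrAC mulrA.
(* For a kernel vector, the row of a coordinate of largest modulus contradicts diagonal
   dominance. *)
have detN0 : phi (\det A) != 0.
  rewrite -det_map_mx -det_tr; apply/det0P => -[v v0 vA].
  have /rV0Pn[k0 vk0] := v0.
  have [j _ jmax] := arg_maxP (fun k => `|v 0 k|) (erefl true : xpredT k0).
  have vj : 0 < `|v 0 j|.
    by apply: lt_le_trans (jmax k0 isT); rewrite normr_gt0.
  have Sz : \sum_k evZ ((f j).2 k) y * v 0 k = 0.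
    have d0 : (denq (f j).1.1)%:~R != 0 :> R by rewrite intr_eq0 denq_neq0.
    apply: (mulfI d0); rewrite mulr0.
    have := congr1 (fun w : 'rV_p => w 0 j) vA; rewrite !mxE => v0E.
    rewrite -[RHS]v0E mulr_sumr; apply: eq_bigr => k _.
    by rewrite !mxE rmorphM phiC phiE mulrA mulrC.
  have vjE : v 0 j = - \sum_k (evZ ((f j).2 k) y - (k == j :> nat)%:R) * v 0 k.
    under eq_bigr do rewrite mulrBl.
    rewrite sumrB Sz sub0r opprK (bigD1 j) //= eqxx mul1r big1 ?addr0 // => k kj.
    by rewrite (_ : (k == j :> nat) = false) ?mul0r //; apply/negbTE.
  have : `|v 0 j| * p.+1%:R <= `|v 0 j| * p%:R.
    rewrite {1}vjE normrN; apply: le_trans (ler_wpM2r (ler0n R p.+1) (ler_norm_sum _ _ _)) _.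
    have -> : p%:R = \sum_(k < p) 1 :> R by rewrite sumr_const card_ord.
    rewrite mulr_suml mulr_sumr ler_sum // => k _.
    have [_ /(_ k) Qk] := fP j.
    rewrite mulr1 normrM mulrAC.
    by apply: le_trans (ler_wpM2r (normr_ge0 _) Qk) _; rewrite mul1r; exact: jmax.
  by rewrite ler_pM2l // ler_nat ltnn.
exists (\det A), (fun k => (\adj A *m rhs) k 0); split=> // k.
have : map_mx phi (\adj A *m A) *m ev = map_mx phi (\adj A *m rhs).
  by rewrite !map_mxM -mulmxA rel.
move/(congr1 (fun w : 'cV_p => w k 0)).
by rewrite mul_adj_mx map_scalar_mx mul_scalar_mx !mxE.
Qed.

Lemma rational_relation (q : rat) : 0 <= (ratr q : R) < 1 ->
  exists (m : nat) (Q : 'I_p -> {poly int}), (0 < m)%N /\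
    (1 - y ^+ m) * ratr q = \sum_(k < p) e k * evZ (Q k) y.
Proof.
move=> q01; have [n [m [m0 E]]] := periodic_remainder p_gt0 hB 0 q01 (per q01).
exists m, (fun k => period_poly B (ratr q) k n m); split=> //.
exact: period_poly_sum.
Qed.

Lemma ratr_invn_itv n : (1 < n)%N -> 0 <= (ratr n%:R^-1 : R) < 1.
Proof.
move=> n1; rewrite fmorphV rmorph_nat invr_ge0 ler0n /= invf_lt1 ?ltr1n //.
by rewrite ltr0n ltnW.
Qed.

Lemma inv_beta_algebraic : exists g : {poly int}, g != 0 /\ evZ g y = 0.
Proof.
have [D [N [D0 DN]]] := inv_base_prod_ratio.
(* [n] exceeds the leading coefficient of [D] in absolute value, so cannot divide it; the 2 also
   ensures [1 < n]. *)
pose n := (`|lead_coef D|%N + 2)%N.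
have n1 : (1 < n)%N by rewrite /n addn2.
have [m [Q [m0 E]]] := rational_relation (ratr_invn_itv n1).
pose S := \sum_(k < p) N k * Q k.
exists (D * ('X^m - 1%:P) + n%:Z%:P * S); split; last first.
  rewrite rmorphD !rmorphM rmorphB /= map_polyXn !map_polyC !(hornerE, hornerXn) /=.
  have -> : evZ S y = evZ D y * ((1 - y ^+ m) * ratr n%:R^-1).
    rewrite E mulr_sumr rmorph_sum horner_sum; apply: eq_bigr => k _.
    by rewrite rmorphM hornerM mulrA DN.
  have n0 : n%:R != 0 :> R by rewrite pnatr_eq0 /n addn2.
  by rewrite fmorphV rmorph_nat; field.
apply/eqP => /addr0_eq/(congr1 lead_coef).
rewrite lead_coefN !lead_coefM lead_coefXnsubC // mulr1 lead_coefC => lE.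
have lD : lead_coef D != 0.
  by rewrite lead_coef_eq0; apply: contraNneq D0 => ->; rewrite rmorph0 horner0.
move: (congr1 absz lE) lD; rewrite abszN abszM /n -absz_gt0.
move: (absz (lead_coef D)) (absz (lead_coef S)) => u [|v] /=; first by rewrite muln0; lia.
by move=> + u0; nia.
Qed.

(** As [y] is algebraic, the inverse of [D] at [y] is a rational polynomial in [y]; [a] clears its
    denominators. *)
Lemma inv_base_prod_integral_mul : exists (a : nat) (N : 'I_p -> {poly int}),
  (0 < a)%N /\ forall k : 'I_p, a%:R * e k = evZ (N k) y.
Proof.
have [g [g0 gy]] := inv_beta_algebraic.
have [D [N [D0 DN]]] := inv_base_prod_ratio.
have gQ0 : map_poly (intr : int -> rat) g != 0.
  by rewrite map_poly_eq0_id0 // intr_eq0 lead_coef_eq0.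
have [||f [_ irr fy]] := @min_poly_exists R y (map_poly intr g) => //.
  by rewrite horner_ratr_intr.
have DQ : evQ (map_poly intr D) y != 0 by rewrite horner_ratr_intr.
have [h hD] := irreducible_inverse irr fy DQ.
have [h' [a a0 hE]] := rat_poly_scale h.
exists `|a|%N, (fun k => (sgz a)%:P * h' * N k); split; first by rewrite absz_gt0.
move=> k; have h'y := horner_intr_ratrZ y a0 hE.
rewrite !rmorphM !hornerM /= map_polyC hornerC -DN h'y horner_ratr_intr in hD *.
rewrite -[RHS]mulrA [(a%:~R * _) * _]mulrA -[a%:~R * _ * _]mulrA hD mulr1 mulrA -intrM.
by rewrite -abszEsg.
Qed.

Lemma beta_integral : algebraic_integer beta.
Proof.
have /andP[y0 y1] := y01.
have [g [g0 gy]] := inv_beta_algebraic.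
have [a [N [a0 aN]]] := inv_base_prod_integral_mul.
have gQ0 : map_poly (intr : int -> rat) g != 0.
  by rewrite map_poly_eq0_id0 // intr_eq0 lead_coef_eq0.
have [||f [_ irr fy]] := @min_poly_exists R y (map_poly intr g) => //.
  by rewrite horner_ratr_intr.
have [h' [c c0 fE]] := rat_poly_scale f.
pose h := zprimitive h'.
have cc : zcontents h' != 0.
  rewrite zcontents_eq0; apply/eqP => h0; have [s _] := irr.
  by move: s; rewrite fE h0 rmorph0 scaler0 size_poly0.
have h'y : evZ h' y = 0 by rewrite (horner_intr_ratrZ y c0 fE) (rootP fy) mulr0.
have hy : evZ h y = 0.
  move: h'y; rewrite [h']zpolyEprim map_polyZ hornerZ => /eqP.
  by rewrite mulf_eq0 intr_eq0 (negbTE cc) => /eqP.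
apply: (@reverse_poly_integral _ h); rewrite ?base_prod_neq0 //.
(* If the constant coefficient is 0, the value 2 serves, since [1 - 2 * w = 0] has no integer
   solution. *)
pose n := if h`_0 == 0 then 2%N else `|(h`_0)%R|%N.
apply/eqP; apply: contraT => h1.
have n1 : (1 < n)%N.
  rewrite /n; case: ifPn => // h0; move: h1 h0; rewrite -absz_gt0.
  by case: absz => [|[]].
have an1 : (1 < a * n)%N by rewrite (leq_trans n1) // leq_pmull.
have [m [Q [m0 E]]] := rational_relation (ratr_invn_itv an1).
pose S := \sum_(k < p) N k * Q k.
(* The relation for [1 / (a * n)], where [a] has been absorbed by the [N k]. *)
pose G : {poly int} := 1 - 'X^m - n%:Z%:P * S.
have Gy : evZ G y = 0.
  rewrite /G !rmorphB rmorphM /= rmorph1 map_polyXn map_polyC !(hornerE, hornerXn) /=.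
  have -> : evZ S y = a%:R * ((1 - y ^+ m) * ratr (a * n)%:R^-1).
    rewrite E mulr_sumr rmorph_sum horner_sum; apply: eq_bigr => k _.
    by rewrite rmorphM hornerM mulrA aN.
  have n0 : n%:R != 0 :> R by rewrite pnatr_eq0 -lt0n ltnW.
  have a0' : a%:R != 0 :> R by rewrite pnatr_eq0 -lt0n.
  by rewrite fmorphV rmorph_nat natrM; field; rewrite n0.
have fG : f %| map_poly intr G.
  by apply: irreducible_dvd irr fy _; rewrite horner_ratr_intr.
have hG : h' %| G by rewrite -dvdp_rat_int -(dvdpZl _ _ (_ : c%:~R^-1 != 0)) -?fE ?invr_eq0 ?intr_eq0.
(* By Gauss's lemma the primitive [h] divides [G] over the integers; the constant coefficients then
   show that [h] has a unit at 0. *)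
have [s Gs] := dvdpP_int hG.
have : G`_0 = h`_0 * s`_0 by rewrite Gs coef0M.
rewrite /G !coefB coef1 coefXn (ltn_eqF m0) coefCM /= subr0.
move: h1; rewrite /n; move: (h`_0) (s`_0) (S`_0) => u v w.
case: (eqVneq u 0) => [->|u0] h1 Eq; first by lia.
have : u * (v + sgz u * w) = 1.
  by rewrite mulrDr -Eq mulrA [u * sgz u]mulrC -abszEsg subrK.
by move/(congr1 absz)/eqP; rewrite abszM muln_eq1 (negbTE h1).
Qed.

(** Each base entry is a quotient of consecutive inverse products, in which [D] cancels; before the
    first entry the product is empty. *)
Lemma Qfield_tnth_base (i : 'I_p) : Qfield beta (tnth B i).
Proof.
have [D [N [D0 DN]]] := inv_base_prod_ratio.
have N0 k : evZ (N k) y != 0 by rewrite -DN mulf_neq0 ?invr_neq0 ?base_prod_neq0.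
have b0 : beta != 0 by apply: base_prod_neq0.
have [M ME] : exists M : {poly int}, evZ D y / base_prod B i = evZ M y.
  case: i => -[|k] kp /=; first by exists D; rewrite base_prod0 divr1.
  by exists (N (Ordinal (ltnW kp))); rewrite -DN.
rewrite -base_mod_small.
have -> : base B i = evZ M y / evZ (N i) y.
  rewrite -ME -DN base_prodS; field.
  by rewrite !(base_prod_neq0 p_gt0 hB) D0 (lt0r_neq0 (base_gt0 p_gt0 hB i)).
exact: Qfield_ratio_inv.
Qed.

(** Reversal turns a relation at [y] into one at [beta], irreducibility carries it to [z], and
    reversal brings it to [z^-1]. *)
Lemma conjugate_inv_transfer (z : R[i]) (g : {poly int}) : z != 0 ->
  galois_conjugate beta z -> evZ g y = 0 -> evZ g z^-1 = 0.
Proof.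
move=> z0 [f [_ irr fb] fz] gy.
have b0 : beta != 0 by apply: base_prod_neq0.
have : evQ (map_poly intr (reverse_poly g)) z = 0.
  apply: (irreducible_root_transfer irr fb fz).
  by rewrite horner_ratr_intr horner_reverse_poly // gy mulr0.
rewrite horner_ratr_intr horner_reverse_poly // => /eqP.
by rewrite mulf_eq0 expf_eq0 (negbTE z0) andbF => /eqP.
Qed.

Lemma conjugate_le1 (z : R[i]) : galois_conjugate beta z ->
  z <> beta%:C%C -> `|z| <= 1.
Proof.
have /andP[y0 y1] := y01; move=> cz zb.
rewrite real_leNgt ?normr_real // ?real1 //; apply/negP => z1.
have z0 : z != 0 by rewrite -normr_gt0 (lt_trans ltr01).
pose w := z^-1.
have w1 : `|w| < 1 by rewrite normfV invf_lt1 // normr_gt0.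
(* [omega], [kappa] and [gamma] are real copies of complex moduli, to which [squeeze_geometric] can
   apply. *)
have [omega omegaE] : exists t : R, `|w| = t%:C%C by apply/complex_realP/normr_real.
have [a [N [a0 aN]]] := inv_base_prod_integral_mul.
have [kappa kappaE] : exists t : R, \sum_(k < p) `|evZ (N k) w| = t%:C%C.
  by apply/complex_realP; rewrite ger0_real // sumr_ge0.
have [gamma gammaE] : exists t : R, `|y%:C%C - w| * (1 - `|w|) = t%:C%C.
  by apply/complex_realP; rewrite realM ?normr_real // realB ?real1 ?normr_real.
have a0C : a%:R != 0 :> R[i] by rewrite pnatr_eq0 -lt0n.
have pl : (p.-1 < p)%N by rewrite prednK.
(* The last inverse product is [y] itself, so the last [N] minus [a] times ['X] vanishes at [y],
   hence at [w]. *)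
have Nlast : evZ (N (Ordinal pl)) w = a%:R * w.
  have := @conjugate_inv_transfer z (N (Ordinal pl) - a%:Z%:P * 'X) z0 cz.
  rewrite !rmorphB !rmorphM /= !map_polyX !map_polyC !(hornerE, hornerX) /= -/w.
  by rewrite -aN /= prednK // subrr => /(_ erefl)/eqP; rewrite subr_eq0 => /eqP.
have bound M : gamma <= y ^+ M.+1 + (1 + (2 * digit_max B)%:R * kappa) * omega ^+ M.+1.
  have [q [m [Q [Mm qy q01 E b]]]] := rational_approximant p_gt0 hB M per pl.
  (* The relation for [q] with denominators cleared, ready to be moved from [y] to [w]. *)
  pose g : {poly int} := (a%:Z * numq q)%:P * (1 - 'X^m) -
    (denq q)%:P * \sum_(k < p) N k * Q k.
  have dq F : (denq q)%:~R != 0 :> (F : numFieldType) by rewrite intr_eq0 denq_neq0.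
  have gE (F : numFieldType) (u : F) : evZ g u = (denq q)%:~R *
     (a%:R * (1 - u ^+ m) * ratr q - \sum_(k < p) evZ (N k) u * evZ (Q k) u).
    rewrite /g rmorphB !rmorphM rmorphB /= rmorph1 map_polyXn !map_polyC.
    rewrite !(hornerE, hornerXn) /= rmorph_sum horner_sum ?intrM.
    rewrite (_ : \sum_(k < p) _ = \sum_(k < p) evZ (N k) u * evZ (Q k) u); last first.
      by apply: eq_bigr => k _; rewrite rmorphM hornerM.
    by rewrite /ratr; field; exact: dq.
  have gw : evZ g w = 0.
    apply: (conjugate_inv_transfer z0 cz).
    rewrite gE -mulrA E mulr_sumr -sumrB big1 ?mulr0 // => k _.
    by rewrite mulrA aN subrr.
  have {gw} Ew : a%:R * ((1 - w ^+ m) * ratr q - w) =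
      \sum_(k < p) evZ (N k) w * (evZ (Q k) w - (k == p.-1 :> nat)%:R).
    move/eqP: gw; rewrite gE mulf_eq0 (negbTE (dq _)) subr_eq0 /= => /eqP gw.
    under [RHS]eq_bigr do rewrite mulrBr.
    rewrite sumrB -gw mulrBr mulrA (bigD1 (Ordinal pl)) //= eqxx mulr1 Nlast.
    rewrite big1 ?addr0 // => k kp; rewrite (_ : (k == p.-1 :> nat) = false) ?mulr0 //.
    by apply/negbTE.
  have w0 : 0 <= 1 - `|w| by rewrite subr_ge0 ltW.
  have bw : `|(1 - w ^+ m) * ratr q - w| * (1 - `|w|) <=
      (2 * digit_max B)%:R * kappa%:C%C * `|w| ^+ M.+1.
    apply: le_trans (_ : `|a%:R * ((1 - w ^+ m) * ratr q - w)| * (1 - `|w|) <= _).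
      by rewrite normrM normr_nat ler_wpM2r // ler_peMl // ler1n.
    rewrite Ew -kappaE; apply: le_trans (ler_wpM2r w0 (ler_norm_sum _ _ _)) _.
    rewrite mulr_suml mulr_sumr mulr_suml ler_sum // => k _.
    by rewrite normrM -mulrA [_%:R * _]mulrC -mulrA ler_wpM2l ?b.
  have qyC : `|y%:C%C - ratr q| <= (y ^+ M.+1)%:C%C.
    rewrite prednK // in qy.
    rewrite distrC -(fmorph_rat (real_complex R)) -rmorphB /= normc_def /= expr0n addr0 sqrtr_sqr.
    by rewrite lecR.
  have wm : `|w ^+ m * ratr q| <= `|w| ^+ M.+1.
    rewrite normrM normrX -[leRHS]mulr1; apply: ler_pM; rewrite ?exprn_ge0 //.
      by apply: ler_wiXn2l => //; apply: ltW.
    rewrite -(fmorph_rat (real_complex R)) /= normc_def /= expr0n addr0 sqrtr_sqr.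
    by case/andP: q01 => q0 q1; rewrite (lecR _ 1) ger0_norm // ltW.
  have rhsE : (y ^+ M.+1 + (1 + (2 * digit_max B)%:R * kappa) * omega ^+ M.+1)%:C%C =
      (y ^+ M.+1)%:C%C + (`|w| ^+ M.+1 +
        (2 * digit_max B)%:R * kappa%:C%C * `|w| ^+ M.+1).
    by rewrite omegaE !(rmorphD, rmorphM, rmorphXn, rmorph1, rmorph_nat) /=; ring.
  rewrite -lecR rhsE -gammaE.
  (* Three small terms: [q] is near [y], [w ^+ m] is small, and the relation at [w] puts
     [(1 - w ^+ m) * q] near [w]. *)
  have -> : y%:C%C - w = (y%:C%C - ratr q) + w ^+ m * ratr q + ((1 - w ^+ m) * ratr q - w).
    by ring.
  apply: le_trans (ler_wpM2r w0 (ler_normD _ _)) _; rewrite mulrDl.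
  apply: le_trans (lerD _ bw) _.
    by apply: le_trans (ler_wpM2r w0 (ler_normD _ _)) (lexx _).
  rewrite addrA lerD // mulrDl lerD //.
    by apply: le_trans _ qyC; rewrite ler_piMr // lerBlDr lerDl.
  by apply: le_trans _ wm; rewrite ler_piMr // lerBlDr lerDl.
have : gamma <= 0.
  apply: squeeze_geometric bound; rewrite ?y0 //.
  - by rewrite -lecR -ltcR -omegaE normr_ge0.
  - by rewrite addr_ge0 // mulr_ge0 // -lecR -kappaE sumr_ge0.
rewrite -lecR -gammaE; apply/negP; rewrite lt_geF //.
rewrite mulr_gt0 ?subr_gt0 // normr_gt0 subr_eq0.
apply/eqP => yw; apply: zb.
by rewrite -[z]invrK -/w -yw fmorphV invrK.
Qed.

End RationalsPeriodic.

(** * Pisot bases *)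

Section PisotBase.
Variables (R : realType) (p : nat) (B : p.-tuple R).
Hypotheses (p_gt0 : (0 < p)%N) (hB : alternate_base B).

Local Notation beta := (base_prod B p).
Local Notation y := beta^-1.
Local Notation e k := (base_prod B k.+1)^-1.

Hypotheses (pisot : Pisot beta) (QB : forall i, Qfield beta (tnth B i)).

Let b0 : beta != 0. Proof. exact: base_prod_neq0. Qed.

Let min_poly : exists f, is_min_poly beta f.
Proof.
have [_ [h hm hb] _] := pisot.
apply: (@min_poly_exists R beta (map_poly intr h)).
  by rewrite map_poly_eq0_id0 ?intr_eq0 ?lead_coef_eq0 ?monic_neq0.
by rewrite horner_ratr_intr; apply/rootP.
Qed.

Lemma Qfield_inv_base_prod n : Qfield beta (base_prod B n)^-1.
Proof.
elim: n => [|n IH].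
  by exists 1, 1; rewrite base_prod0 rmorph1 hornerC oner_neq0 divr1 invr1.
rewrite base_prodS invfM; apply: Qfield_mul => //; apply: Qfield_inv.
have -> : base B n = tnth B (Ordinal (ltn_pmod n p_gt0)).
  by rewrite -base_mod_small /base /= modn_mod.
exact: QB.
Qed.

(** The period relation is solved for [x], the factor [1 - y ^+ m] being nonzero. *)
Lemma Per_Qfield x : Per B x -> Qfield beta x.
Proof.
move=> [x01 per]; have [f mf] := min_poly.
have [n [m [m0 E]]] := periodic_remainder p_gt0 hB 0 x01 per.
have /choice[P PE] := fun k : 'I_p => Qfield_poly mf (Qfield_inv_base_prod k.+1).
(* Composition with [Y] turns polynomials in [y] into polynomials in [beta]. *)
have [Y YE] := Qfield_poly mf (Qfield_inv_base_prod p).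
have comp (Q : {poly int}) : evQ (map_poly intr Q \Po Y) beta = evZ Q y.
  by rewrite map_comp_poly horner_comp /= -YE horner_ratr_intr.
have ym : 1 - y ^+ m != 0.
  rewrite subr_eq0 eq_sym lt_eqF // exprn_ilt1 ?invr_ge0 ?(ltW (base_prod_gt0 _ _ _)) //.
  - by rewrite -lt0n.
  - by rewrite invf_lt1 ?base_prod_gt0 ?beta_gt1.
exists (\sum_(k < p) P k * (map_poly intr (period_poly B x k n m) \Po Y)),
  (map_poly intr (1 - 'X^m) \Po Y).
rewrite comp rmorphB rmorph1 /= map_polyXn !(hornerE, hornerXn).
split=> //; apply: (mulIf ym); rewrite divfK // mulrC (period_poly_sum p_gt0 hB E).
rewrite rmorph_sum horner_sum; apply: eq_bigr => k _.
by rewrite rmorphM hornerM /= comp -PE.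
Qed.

(** Comparing [digit_poly_sum] at [N] and [N.+1] shows that every block of [p] steps has the same
    multiplier and the same weights. *)
Lemma block_remainder x N : remainder B x (p * N.+1) =
  beta * (remainder B x (p * N) - \sum_(k < p) e k * (expansion B x (p * N + k))%:~R).
Proof.
have yN : y ^+ N.+1 != 0 by rewrite expf_neq0 ?invr_neq0.
apply: (mulfI yN).
have D n : y ^+ n * remainder B x (p * n) =
    x - \sum_(k < p) e k * evZ (digit_poly B x k n) y.
  by rewrite -(digit_poly_sum p_gt0 hB) subKr.
rewrite D exprSr -[RHS]mulrA mulKf // mulrBr D -addrA -opprD; congr (x - _).
rewrite mulr_sumr -big_split; apply: eq_bigr => k _.
by rewrite digit_polyS /=; ring.
Qed.

(* If [D x = X(beta)] and [D e_k = N_k(beta)], then the value at [beta] is [D]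
   times the remainder of rank [p n]. *)
Fixpoint block_poly (X : {poly int}) (N : 'I_p -> {poly int}) (x : R) (n : nat) : {poly int} :=
  if n is n'.+1 then
    'X * (block_poly X N x n' -
          \sum_(k < p) (expansion B x (p * n' + k))%:P * N k)
  else X.

Lemma block_polyS (F : numFieldType) X N x n (u : F) :
  evZ (block_poly X N x n.+1) u = u * (evZ (block_poly X N x n) u -
    \sum_(k < p) (expansion B x (p * n + k))%:~R * evZ (N k) u).
Proof.
rewrite /= rmorphM rmorphB /= map_polyX !hornerE rmorph_sum horner_sum; congr (_ * (_ - _)).
by apply: eq_bigr => k _; rewrite rmorphM hornerM /= map_polyC hornerC.
Qed.

(* [K] is chosen so that [|z| (K + C) <= K], with [C] a bound for the digit part. *)
Lemma block_poly_bounded X N x (z : R[i]) : 0 <= x < 1 -> `|z| < 1 ->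
  exists K : R, forall n, `|evZ (block_poly X N x n) z| <= K%:C%C.
Proof.
move=> x01 z1; pose C := (digit_max B)%:R * \sum_(k < p) `|evZ (N k) z|.
have C0 : 0 <= C by rewrite mulr_ge0 // sumr_ge0.
have z1' : 0 < 1 - `|z| by rewrite subr_gt0.
pose K := `|evZ X z| + C / (1 - `|z|).
have [k kE] : exists k : R, K = k%:C%C.
  by apply/complex_realP; rewrite ger0_real // addr_ge0 // divr_ge0 // ltW.
exists k => n; rewrite -kE; elim: n => [|n IH].
  by rewrite /= lerDl divr_ge0 // ltW.
rewrite block_polyS normrM; apply: le_trans (_ : `|z| * (K + C) <= _).
  apply: ler_wpM2l => //; apply: le_trans (ler_normB _ _) _; apply: lerD IH _.
  apply: le_trans (ler_norm_sum _ _ _) _; rewrite /C mulr_sumr ler_sum // => j _.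
  by rewrite normrM ler_wpM2r // norm_expansion.
rewrite -subr_ge0 (_ : _ - _ = `|evZ X z| * (1 - `|z|) + C * (1 - `|z|)); last first.
  by rewrite /K; field; rewrite lt0r_neq0.
by apply: addr_ge0; apply: mulr_ge0 => //; apply: ltW.
Qed.

Lemma Qfield_Per x : 0 <= x < 1 -> Qfield beta x -> ult_periodic (expansion B x).
Proof.
move=> x01 Qx; have [f mf] := min_poly.
have [_ bint conj] := pisot.
have [fm irr fb] := mf.
have /choice[P PE] := fun k : 'I_p => Qfield_poly mf (Qfield_inv_base_prod k.+1).
have [Px PxE] := Qfield_poly mf Qx.
(* [None] stands for [x] and [Some k] for [e k], so that one [D] serves all. *)
have [D [N' [D0 NE]]] := common_denominator (fun o : option 'I_p => if o is Some k then P k else Px).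
pose G := block_poly (N' None) (fun k => N' (Some k)) x.
have GE n : evZ (G n) beta = D%:~R * remainder B x (p * n).
  elim: n => [|n IH]; first by rewrite /= NE -PxE muln0.
  rewrite block_polyS -/(G n) IH block_remainder.
  rewrite [RHS]mulrCA [D%:~R * (_ - _)]mulrBr mulr_sumr; congr (_ * (_ - _)); apply: eq_bigr => k _.
  by rewrite NE -PE; ring.
have [g gm gf] := monic_integral_min_poly bint mf.
have [s us fs] := irreducible_uniq_roots (ratr : rat -> R[i]) fm irr.
pose d := (size g).-1.
have sd : size s = d.
  have := congr1 (fun q : {poly _} => size q) fs.
  rewrite size_prod_XsubC size_map_poly -gf size_map_poly_id0; last first.
    by rewrite (monicP gm) oner_neq0.
  by rewrite /d => ->.
pose z (j : 'I_d) := s`_j.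
have zI : injective z.
  by move=> i j /eqP; rewrite nth_uniq ?sd // => /eqP/val_inj.
have zroot j : root (map_poly ratr f) (z j).
  by rewrite fs root_prod_XsubC mem_nth ?sd.
(* Division by the monic [g] keeps the coefficients integral and the values at all conjugates, and
   leaves only [d] coefficients. *)
pose rem n := Pdiv.CommonRing.rmodp (G n) g.
have srem n : (size (rem n) <= d)%N.
  have := Pdiv.CommonRing.ltn_rmodpN0 (G n) (monic_neq0 gm).
  by rewrite -/(rem n) -[X in (_ < X)%N]prednK // size_poly_gt0 monic_neq0.
have remE (F : numFieldType) (u : F) n : root (map_poly ratr f) u ->
    evZ (rem n) u = evZ (G n) u.
  move=> fu; rewrite [in RHS](Pdiv.RingMonic.rdivp_eq gm (G n)) rmorphD rmorphM /=.
  rewrite hornerD hornerM -(horner_ratr_intr g) gf (rootP fu) mulr0 add0r //.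
have /choice[K KE] : forall j, exists K : R, forall n, `|evZ (G n) (z j)| <= K%:C%C.
  (* At [beta] itself nothing contracts; there the bound comes from the remainders being below 1. *)
  move=> j; have [zb|/eqP zb] := eqVneq (z j) beta%:C%C.
    have [K KE] : exists K : R, `|D%:~R : R[i]| = K%:C%C by apply/complex_realP/normr_real.
    exists K => n; have -> : evZ (G n) (z j) = (evZ (G n) beta)%:C%C.
      rewrite zb -horner_map -map_poly_comp; congr (_.[_]).
      by apply: eq_map_poly => a /=; rewrite rmorph_int.
    rewrite GE rmorphM /= rmorph_int normrM KE -[leRHS]mulr1.
    have /andP[r0 r1] := remainder_itv B (p * n) x01.
    have K0 : 0 <= K%:C%C by rewrite -KE.
    rewrite ler_wpM2l // normc_def /= expr0n addr0 sqrtr_sqr.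
    by rewrite (lecR _ 1) ger0_norm // ltW.
  by apply: block_poly_bounded => //; apply: conj => //; exists f.
have [b bE] := Vandermonde_coef_bound K zI.
have coef_b n i : (`|((rem n)`_i)%R| <= b)%N.
  have [di|id] := leqP d i; first by rewrite nth_default // (leq_trans (srem n)).
  apply: (bE (fun i : 'I_d => (rem n)`_i) _ (Ordinal id)) => j.
  have := KE j n; rewrite -(remE _ _ n (zroot j)) (horner_coef_wide _ (_ : _ <= d)%N).
    by under eq_bigr do rewrite coef_map.
  exact: leq_trans (size_poly _ _) (srem n).
(* Adding [b] moves the coefficients into the range from 0 to [2 * b], so there are finitely many
   codes. *)
pose code n : {ffun 'I_d -> 'I_(2 * b).+1} :=
  [ffun i : 'I_d => inord `|((rem n)`_i + b%:Z)%R|%N].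
have [i [j [ij cij]]] := pigeonhole_nat code.
have remij : rem i = rem j.
  apply/polyP => k; have [dk|kd] := leqP d k.
    by rewrite !nth_default // (leq_trans (srem _)).
  have := congr1 (fun c : {ffun _ -> _} => nat_of_ord (c (Ordinal kd))) cij.
  rewrite !ffunE /=; have := coef_b j k; have := coef_b i k.
  move: ((rem i)`_k) ((rem j)`_k) => u v ub vb; rewrite !inordK; lia.
apply: (@remainder_periodic _ _ _ p_gt0 x i (j - i)); first by rewrite subn_gt0.
rewrite subnKC 1?ltnW //; apply: (@mulfI _ (D%:~R)); first by rewrite intr_eq0.
by rewrite -!GE -!remE // remij.
Qed.

End PisotBase.

(** * The zeroth shift, and assembly of both implications *)

Lemma expansion_shift0 (R : realType) (p : nat) (B : p.-tuple R) (x : R) :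
  (0 < p)%N -> expansion (shift_base B 0) x = expansion B x.
Proof.
move=> p_gt0.
have bE n : base (shift_base B 0) n = base B n.
  by rewrite /base -(tnth_nth 0 _ (Ordinal (ltn_pmod n p_gt0))) tnth_mktuple /base /= modn_mod.
have rE n : remainder (shift_base B 0) x n = remainder B x n.
  by elim: n => //= n ->; rewrite bE.
by apply/funext => n; rewrite /expansion bE rE.
Qed.

Theorem theorem1 (R : realType) (p : nat) (hp : (1 <= p)%N)
    (B : p.-tuple R) (hB : alternate_base B)
    (beta : R) (hbeta : beta = \prod_(i < p) tnth B i) :
  (range (ratr : rat -> R) `&` `[0, 1[ `<=`
     \bigcap_(i in [set: 'I_p]) Per (shift_base B i) ->
   (forall i : 'I_p, Qfield beta (tnth B i)) /\ (Pisot beta \/ Salem beta))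
  /\
  (Pisot beta -> (forall i : 'I_p, Qfield beta (tnth B i)) ->
   Per B = Qfield beta `&` `[0, 1[).
Proof.
have -> : beta = base_prod B p.
  by rewrite hbeta; apply: eq_bigr => i _; rewrite base_mod_small.
split=> [ratPer|pisot QB].
  have per (q : rat) : 0 <= (ratr q : R) < 1 -> ult_periodic (expansion B (ratr q)).
    move=> q01; rewrite -expansion_shift0 //.
    have rq : (range (ratr : rat -> R) `&` `[0, 1[) (ratr q).
      by split; [exists q|rewrite /= in_itv].
    (* [Ordinal hp] is the index 0, as [1 <= p] is [0 < p]. *)
    by have [] := ratPer _ rq (Ordinal hp) I.
  split; first exact: Qfield_tnth_base.
  have b1 := beta_gt1 hp hB; have bint := beta_integral hp hB per.
  have conj1 := conjugate_le1 hp hB per.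
  have [salem|npisot] := pselect (exists z, [/\ galois_conjugate (base_prod B p) z,
      z <> (base_prod B p)%:C%C & `|z| = 1]); first by right.
  left; split=> // z cz zb; rewrite lt_neqAle conj1 // andbT.
  by apply/eqP => z1; apply: npisot; exists z.
apply/seteqP; split=> [x Px|x [Qx]] /=.
  by split; [exact: Per_Qfield|rewrite in_itv /=; case: Px].
by rewrite in_itv /= => x01; split=> //; apply: Qfield_Per.
Qed.
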